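(* For any integers $n\ge 1$ and $k\ge 1$ and any integer $m\ge 0$, $$\sum_{N_k=1}^{n}\cdots\sum_{N_1=1}^{N_2}\left[\binom{N_1+m}{m}\sum_{i=1+m}^{N_1+m}\frac{1}{i}\right]=\sum_{i=1}^{n}\frac{(-1)^{i+1}}{i}\binom{m+k+n}{m+k+i}.$$
   Context: The outer sum on the left-hand side is a $k$-fold nested sum over integers $1\le N_1\le N_2\le\cdots\le N_k\le n$; for $k=1$ it is a single sum over $N_1$ from $1$ to $n$. *)

(* Defs.v *)
From mathcomp Require Import all_boot all_order all_algebra.

Set Implicit Arguments.
Unset Strict Implicit.
Unset Printing Implicit Defensive.

Import GRing.Theory.
Local Open Scope ring_scope.

(* nested_sum k f n is
     \sum_(N_k = 1 .. n) \sum_(N_{k-1} = 1 .. N_k) ... \sum_(N_1 = 1 .. N_2) f N_1,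
   with k summation signs, the outermost being unfolded first; zero signs
   give f n. *)
Fixpoint nested_sum (k : nat) (f : nat -> rat) (n : nat) : rat :=
  if k is k'.+1 then \sum_(1 <= N < n.+1) nested_sum k' f N else f n.

(* Main.v *)
(* Both sides are the (m + k + 1)-fold nested sum of N |-> 1 / N. Writing L m n
   for the inner summand at N_1 = n and R (m + k) n for the right-hand side, the
   identity F (a + 1) (n + 1) - F (a + 1) n = F a (n + 1), which says that
   F (a + 1) is the summation of F a, holds for F = L and for F = R, by Pascal's
   rule. *)
Require Import Defs.
From mathcomp Require Import all_boot all_order all_algebra.

Set Implicit Arguments.
Unset Strict Implicit.
Unset Printing Implicit Defensive.

Import GRing.Theory.
Local Open Scope ring_scope.

Definition recip (n : nat) : rat := 1 / n%:R.

(** The closed form of the hyperharmonic number of order [m.+1]. *)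
Definition binom_harmonic (m n : nat) : rat :=
  'C(n + m, m)%:R * \sum_(1 + m <= i < (n + m).+1) (1 / i%:R).

(* The right-hand side of the theorem is [alt_binom_sum (m + k).+1 n]; the shift
   makes index 0, where the sum is [1 / n] (also for n = 0, as [1 / 0 = 0]),
   available as a base case. *)
Definition alt_binom_sum (b n : nat) : rat :=
  \sum_(1 <= i < n.+1) ((-1) ^+ i.+1 / i%:R) * 'C((b + n).-1, (b + i).-1)%:R.

(** Absorption, used to trade a summation-dependent denominator for a fixed one. *)
Lemma bin_div_diag (n m : nat) :
  'C(n, m)%:R / m.+1%:R = 'C(n.+1, m.+1)%:R / n.+1%:R :> rat.
Proof.
apply/eqP; rewrite eqr_div ?Num.Theory.pnatr_eq0 // -!natrM mulnC.
by rewrite mul_bin_diag mulnC.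
Qed.

Lemma nested_sum_eq (k : nat) (f g : nat -> rat) (n : nat) :
  f =1 g -> nested_sum k f n = nested_sum k g n.
Proof.
by move=> fg; elim: k n => [|k IHk] n //=; apply: eq_bigr => N _; apply: IHk.
Qed.

Lemma nested_sumD (k j : nat) (f : nat -> rat) (n : nat) :
  nested_sum k (nested_sum j f) n = nested_sum (k + j) f n.
Proof. by elim: k n => [|k IHk] n //=; apply: eq_bigr => N _; apply: IHk. Qed.

Lemma sum_by_difference (f F : nat -> rat) (n : nat) :
  F 0%N = 0 -> (forall N, F N.+1 = F N + f N.+1) ->
  \sum_(1 <= N < n.+1) f N = F n.
Proof.
move=> F0 FS; elim: n => [|n IHn]; first by rewrite big_geq.
by rewrite big_nat_recr //= IHn FS.
Qed.

Lemma binom_harmonic0 (m : nat) : binom_harmonic m 0 = 0.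
Proof. by rewrite /binom_harmonic big_geq ?mulr0. Qed.

(** Pascal's rule splits the coefficient of the common sum over m+2..n+m+1. The leftover terms, the
    last on the left and the first on the right, agree by absorption. *)
Lemma binom_harmonicS (m n : nat) :
  binom_harmonic m.+1 n.+1 = binom_harmonic m.+1 n + binom_harmonic m n.+1.
Proof.
rewrite /binom_harmonic !add1n !addSn !addnS.
rewrite [X in _ = _ + _ * X]big_ltn; last by rewrite ltnS ltnS leq_addl.
rewrite big_nat_recr /=; last by rewrite ltnS ltnS leq_addl.
rewrite !mulrDr !mul1r -bin_div_diag {1}binS natrD mulrDl -addrA.
by congr (_ + _); rewrite addrC.
Qed.

Lemma binom_harmonic_nested (m n : nat) :
  binom_harmonic m n = nested_sum m.+1 recip n.
Proof.
elim: m n => [|m IHm] n.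
  by rewrite /binom_harmonic bin0 mul1r !addn0.
rewrite -(@sum_by_difference (binom_harmonic m) (binom_harmonic m.+1) n);
  [|exact: binom_harmonic0|exact: binom_harmonicS].
by apply: eq_bigr => N _; rewrite IHm.
Qed.

(** Expand (1 - 1)^(n+1) = 0 and isolate the constant term. *)
Lemma alternating_bin_sum (n : nat) :
  \sum_(0 <= i < n.+1) (-1) ^+ i * 'C(n.+1, i.+1)%:R = 1 :> rat.
Proof.
have /eqP := exprDn (1 : rat) (-1) n.+1.
rewrite subrr expr0n /= big_ord_recl expr1n expr0 bin0 mulr1 mulr1n.
rewrite eq_sym addr_eq0 => /eqP sum1; rewrite [RHS]sum1.
rewrite -sumrN big_mkord; apply: eq_bigr => i _.
by rewrite expr1n mul1r exprS mulN1r mulNrn opprK mulr_natr.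
Qed.

Lemma alt_binom_sum0 (n : nat) : alt_binom_sum 0 n = recip n.
Proof.
case: n => [|n]; first by rewrite /alt_binom_sum /recip big_geq // invr0 mulr0.
rewrite /alt_binom_sum /recip big_add1 -[X in X / _](alternating_bin_sum n).
(* Termwise, absorption turns 'C(n, i) / (i+1) into 'C(n+1, i+1) / (n+1). *)
rewrite mulr_suml; apply: eq_bigr => i _; rewrite !add0n /= !exprS.
by rewrite !mulN1r opprK mulrAC -mulrA bin_div_diag mulrA.
Qed.

Lemma alt_binom_sumS (b n : nat) :
  alt_binom_sum b.+1 n.+1 = alt_binom_sum b.+1 n + alt_binom_sum b n.+1.
Proof.
(* The added term i = n+1 has the factor 'C(b+n, b+n+1) = 0; with equal ranges, Pascal's rule
   applies termwise. *)
have -> : alt_binom_sum b.+1 n = \sum_(1 <= i < n.+2)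
    ((-1) ^+ i.+1 / i%:R) * 'C((b.+1 + n).-1, (b.+1 + i).-1)%:R.
  by rewrite big_nat_recr //= bin_small ?mulr0 ?addr0 // addnS.
rewrite /alt_binom_sum -big_split !big_add1 /=; apply: eq_bigr => i _.
by rewrite !addnS /= binS natrD mulrDr.
Qed.

Lemma alt_binom_sum_nested (b n : nat) :
  alt_binom_sum b n = nested_sum b recip n.
Proof.
elim: b n => [|b IHb] n; first exact: alt_binom_sum0.
rewrite -(@sum_by_difference (alt_binom_sum b) (alt_binom_sum b.+1) n).
- by apply: eq_bigr => N _; rewrite IHb.
- by rewrite /alt_binom_sum big_geq.
- exact: alt_binom_sumS.
Qed.

Theorem theorem4p3 (n k m : nat) (hn : (1 <= n)%N) (hk : (1 <= k)%N) :
  nested_sum k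
    (fun N1 : nat =>
       'C(N1 + m, m)%:R * \sum_(1 + m <= i < (N1 + m).+1) (1 / i%:R)) n
  = \sum_(1 <= i < n.+1)
      ((-1) ^+ i.+1 / i%:R) * 'C(m + k + n, m + k + i)%:R.
Proof.
rewrite (nested_sum_eq _ _ (binom_harmonic_nested m)) nested_sumD.
(* At index [(m + k).+1] the predecessors in [alt_binom_sum] cancel by computation. *)
by rewrite addnS addnC -alt_binom_sum_nested.
Qed.
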